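(* Let $M$ be a closed oriented triangulated three-dimensional manifold with complex numbers $\zeta_i$ in general position assigned to the vertices $i$ of the triangulation. Then the sequence of vector spaces and linear mappings $$0\longrightarrow \mathfrak{psl}(2,\mathbb C) \stackrel{f_1}{\longrightarrow} (dz) \stackrel{f_2}{\longrightarrow} (dy) \stackrel{f_3}{\longrightarrow} (d\ln\omega)$$ is a chain complex, i.e., $f_3\circ f_2=0$ and $f_2\circ f_1=0$.
   Context: Write $\zeta_{ij}=\zeta_i-\zeta_j$. General position includes $\zeta_{ij}\ne0$ for each edge $ij$. All vector spaces are over $\mathbb C$: $\mathfrak{psl}(2,\mathbb C)$ is represented as the space of column vectors $(da,db,dc)^{\mathrm T}$; $(dz)$, $(dy)$, $(d\ln\omega)$ have bases consisting respectively of all vertices, all tetrahedra, all edges of the triangulation, with coordinates denoted $dz_i$, $dy_{ijkl}$, $d\ln\omega_{ij}$. $f_1$ is defined by $dz_i = 2\zeta_i\,da+db-\zeta_i^2\,dc$ for all vertices $i$. $f_2$ is defined, for every tetrahedron $0123$ oriented according to the orientation of $M$, by differentiating the cross-ratio $x=\frac{z_{01}z_{23}}{z_{03}z_{21}}$ (with $z_{ij}=z_i-z_j$) at $z_i=\zeta_i$ and normalizing: $$dy_{0123}=\frac{d\ln x}{\zeta_{02}\zeta_{31}}=\frac{d\ln(1-\frac1x)}{\zeta_{03}\zeta_{12}}=\frac{d\ln\frac1{1-x}}{\zeta_{01}\zeta_{23}},$$ explicitly $$dy_{0123}=-\frac{dz_0}{\zeta_{01}\zeta_{02}\zeta_{03}}+\frac{dz_1}{\zeta_{01}\zeta_{12}\zeta_{13}}-\frac{dz_2}{\zeta_{02}\zeta_{12}\zeta_{23}}+\frac{dz_3}{\zeta_{03}\zeta_{13}\zeta_{23}},$$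 and similarly for other tetrahedra; $dy_{0123}$ does not change under any permutation of the indices. $f_3$ is defined by $$d\ln\omega_{ij}=\zeta_{ij}\sum_{kl}\zeta_{kl}\,dy_{ijkl},$$ where the sum is over all edges $kl$ in the link of the edge $ij$, with $k,l$ ordered so that $ijkl$ gives the right orientation (that of $M$) of the tetrahedron. *)

(* Defs.v *)
From HB Require Import structures.
From mathcomp Require Import all_boot all_order all_fingroup all_algebra.
From mathcomp Require Import all_classical all_reals all_analysis.
From mathcomp.real_closed Require Export complex.
From mathcomp Require Import ring.

Set Implicit Arguments.
Unset Strict Implicit.
Unset Printing Implicit Defensive.

Import Order.TTheory GRing.Theory Num.Theory.
Import numFieldNormedType.Exports.

Local Open Scope classical_set_scope.
Local Open Scope ring_scope.

(* Finite abstract simplicial complexes are families of nonempty subsets of a *)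
(* finite type. In dimension 3, a simplicial complex triangulates a closed    *)
(* manifold if and only if all its vertex links are 2-spheres.                *)
Section SimplicialComplexes.
Variable V : finType.
Implicit Types (K : {set {set V}}) (s t : {set V}).

Definition simplicial_complex K : Prop :=
  finset.set0 \notin K /\
  (forall s t, s \in K -> t \subset s -> t != finset.set0 -> t \in K).

Definition simplices n K : {set {set V}} := [set s in K | #|s| == n.+1]%SET.

Definition link K s : {set {set V}} :=
  [set t | [&& t != finset.set0, [disjoint t & s] & t :|: s \in K]]%SET.

Definition connected_complex K : Prop :=
  K != finset.set0 /\
  (forall x y, [set x]%SET \in K -> [set y]%SET \in K ->
     connect (fun u v => [set u; v]%SET \in K) x y).

Definition sphere0 K : Prop := #|K| = 2%N /\ simplices 0 K = K.

Definition sphere1 K : Prop :=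
  connected_complex K /\
  (forall v, [set v]%SET \in K -> sphere0 (link K [set v]%SET)).

(* A 2-sphere is a connected closed surface of Euler characteristic 2. *)
Definition sphere2 K : Prop :=
  [/\ connected_complex K,
      (forall v, [set v]%SET \in K -> sphere1 (link K [set v]%SET)) &
      #|simplices 0 K|%:Z - #|simplices 1 K|%:Z + #|simplices 2 K|%:Z = 2].

Definition closed_3manifold K : Prop :=
  forall v, [set v]%SET \in K -> sphere2 (link K [set v]%SET).

Definition permute (s : {perm 'I_4}) (t : 4.-tuple V) : 4.-tuple V :=
  [tuple tnth t (s m) | m < 4].

Definition tetrahedron_ordering K (t : 4.-tuple V) : bool :=
  uniq t && ([set x in t]%SET \in K).

End SimplicialComplexes.

(* Every element of V is a vertex of the triangulation. An orientation singles *)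
(* out the positive orderings of the vertices of each tetrahedron; orderings   *)
(* ijkl and ijkm of two distinct tetrahedra with the same sign induce the same *)
(* orientation on the common face ijk, so adjacent tetrahedra are coherently   *)
(* oriented when these orderings have opposite signs.                          *)
Record oriented_closed_3manifold (V : finType) := OrientedClosed3Manifold {
  complex_of :> {set {set V}};
  complexP : simplicial_complex complex_of;
  vertexP : forall v, [set v]%SET \in complex_of;
  manifoldP : closed_3manifold complex_of;
  positive : pred (4.-tuple V);
  positive_ordering : forall t, positive t -> tetrahedron_ordering complex_of t;
  positive_permute : forall (s : {perm 'I_4}) t,
    tetrahedron_ordering complex_of t ->
    positive (permute s t) = positive t (+) odd_perm s;
  positive_coherent : forall i j k l m, l != m ->
    tetrahedron_ordering complex_of [tuple i; j; k; l] ->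
    tetrahedron_ordering complex_of [tuple i; j; k; m] ->
    positive [tuple i; j; k; l] = ~~ positive [tuple i; j; k; m]
}.

Section Cells.
Variables (V : finType) (M : oriented_closed_3manifold V).

Definition edge := {s : {set V} | s \in simplices 1 M}.
Definition tetrahedron := {s : {set V} | s \in simplices 3 M}.

Lemma tetrahedron_positive (s : tetrahedron) :
  exists t : 4.-tuple V, positive M t && ([set x in t]%SET == val s).
Proof.
case: s => s /=; rewrite inE => /andP[sM /eqP cs].
have sz : size (enum s) == 4%N by rewrite -cardE cs.
pose t : 4.-tuple V := Tuple sz.
have ts : [set x in t]%SET = s by apply/setP => x; rewrite inE mem_enum.
have tM : tetrahedron_ordering M t by rewrite /tetrahedron_ordering enum_uniq ts.
case pt : (positive M t); first by exists t; rewrite pt ts eqxx.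
pose p : {perm 'I_4} := tperm 0 1.
exists (permute p t); rewrite positive_permute // pt odd_tperm /=.
apply/eqP/setP => x; rewrite -ts !inE; apply/tnthP/tnthP => -[i ->].
  by exists (p i); rewrite tnth_mktuple.
by exists (p i); rewrite tnth_mktuple tpermK.
Qed.

Definition ordered_tetrahedron (s : tetrahedron) : 4.-tuple V :=
  xchoose (tetrahedron_positive s).

Lemma edge_ordering (e : edge) :
  exists ij : V * V, (ij.1 != ij.2) && ([set ij.1; ij.2]%SET == val e).
Proof.
case: e => e /=; rewrite inE => /andP[_ /cards2P[i [j [ij ->]]]].
by exists (i, j); rewrite /= ij eqxx.
Qed.

Definition ordered_edge (e : edge) : V * V := xchoose (edge_ordering e).

End Cells.

Section CrossRatio.
Variable C : numFieldType.
Implicit Types z w : 'rV[C]_4.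

Local Notation dif z i j := (z ord0 (i : 'I_4) - z ord0 (j : 'I_4)).

Definition cross_ratio z : C :=
  (dif z 0 1 * dif z 2 3) / (dif z 0 3 * dif z 2 1).

Definition dlog (g : 'rV[C]_4 -> C) z w : C := 'D_w g z / g z.

(* The common value of the three normalized logarithmic differentials in     *)
(* dy_dlog_cross_ratio, dy_dlog_one_minus_inv and dy_dlog_inv_one_minus.     *)
Definition dy z w : C :=
  - (w ord0 0 / (dif z 0 1 * dif z 0 2 * dif z 0 3))
  + w ord0 1 / (dif z 0 1 * dif z 1 2 * dif z 1 3)
  - w ord0 2 / (dif z 0 2 * dif z 1 2 * dif z 2 3)
  + w ord0 3 / (dif z 0 3 * dif z 1 3 * dif z 2 3).

Lemma is_derive_dif (a b : 'I_4) z w :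
  is_derive z w (fun u : 'rV[C]_4 => dif u a b : C) (dif w a b).
Proof.
have E : forall c : 'I_4, is_derive z w (fun u : 'rV[C]_4 => u ord0 c : C) (w ord0 c).
  move=> c.
  have H : (fun h : C => h^-1 *: ((fun u : 'rV[C]_4 => u ord0 c : C) (h *: w + z) - z ord0 c))
     @ 0^' --> w ord0 c.
    apply: cvg_near_cst; near=> h.
    rewrite !mxE addrK scalerA mulVf ?scale1r //.
    by near: h; exact: nbhs_dnbhs_neq.
  by apply: DeriveDef; [apply: cvgP H | apply: cvg_lim H].
exact: is_deriveB.
Unshelve. all: by end_near. Qed.

Definition distinct_entries z : Prop :=
  forall a b : 'I_4, a != b -> z ord0 a != z ord0 b.

Section DistinctEntries.
Variables (z w : 'rV[C]_4).
Hypothesis zP : distinct_entries z.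

Lemma dif_neq0 (a b : 'I_4) : a != b -> dif z a b != 0.
Proof. by move=> ab; rewrite subr_eq0 zP. Qed.

Lemma is_derive_cross_ratio :
  is_derive z w (cross_ratio : _ -> C) (cross_ratio z *
    (dif w 0 1 / dif z 0 1 + dif w 2 3 / dif z 2 3
     - dif w 0 3 / dif z 0 3 - dif w 2 1 / dif z 2 1)).
Proof.
have z01 : dif z 0 1 != 0 by exact: dif_neq0.
have z23 : dif z 2 3 != 0 by exact: dif_neq0.
have z03 : dif z 0 3 != 0 by exact: dif_neq0.
have z21 : dif z 2 1 != 0 by exact: dif_neq0.
have dN := is_deriveM (is_derive_dif 0 1 z w) (is_derive_dif 2 3 z w).
have dD := is_deriveM (is_derive_dif 0 3 z w) (is_derive_dif 2 1 z w).
have D0 : ((fun u : 'rV[C]_4 => dif u 0 3) * (fun u : 'rV[C]_4 => dif u 2 1)) z != 0.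
  by rewrite /GRing.mul /= mulf_neq0.
have dV := derivableP (derivableV D0 (@ex_derive _ _ _ _ _ _ _ dD)).
have H := is_deriveM dN dV.
rewrite (deriveV D0 (@ex_derive _ _ _ _ _ _ _ dD)) (@derive_val _ _ _ _ _ _ _ dD) in H.
have {}H : is_derive z w (cross_ratio : _ -> C) _ := H.
apply: is_derive_eq H _.
rewrite /cross_ratio !mulrfctE /GRing.scale /=.
move: z01 z23 z03 z21; clear.
move: (z _ 0) (z _ 1) (z _ 2) (z _ 3) (w _ 0) (w _ 1) (w _ 2) (w _ 3).
move=> a b c d a' b' c' d' h1 h2 h3 h4.
field.
by rewrite h1 h2 h3 h4.
Qed.

Let dif_simp := (dif_neq0 : forall a b : 'I_4, a != b -> dif z a b != 0).

Lemma cross_ratio_neq0 : cross_ratio z != 0.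
Proof. by rewrite /cross_ratio !(mulf_neq0, invr_eq0, dif_simp). Qed.

Lemma cross_ratio_neq1 : 1 - cross_ratio z != 0.
Proof.
have z03 : dif z 0 3 != 0 by exact: dif_neq0.
have z21 : dif z 2 1 != 0 by exact: dif_neq0.
have z02 : dif z 0 2 != 0 by exact: dif_neq0.
have z31 : dif z 3 1 != 0 by exact: dif_neq0.
have -> : 1 - cross_ratio z = dif z 0 2 * dif z 3 1 / (dif z 0 3 * dif z 2 1).
  rewrite /cross_ratio; move: z03 z21; move: (z _ 0) (z _ 1) (z _ 2) (z _ 3).
  move=> a b c d h1 h2; field.
  by rewrite h2 h1.
by rewrite !(mulf_neq0, invr_eq0, dif_simp).
Qed.

Let x' := @derive_val _ _ _ _ _ _ _ is_derive_cross_ratio.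
Let ex' := @ex_derive _ _ _ _ _ _ _ is_derive_cross_ratio.

Let generic_dy : dy z w = (dif w 0 1 / dif z 0 1 + dif w 2 3 / dif z 2 3
     - dif w 0 3 / dif z 0 3 - dif w 2 1 / dif z 2 1) / (dif z 0 2 * dif z 3 1).
Proof.
have z01 : dif z 0 1 != 0 by exact: dif_neq0.
have z02 : dif z 0 2 != 0 by exact: dif_neq0.
have z03 : dif z 0 3 != 0 by exact: dif_neq0.
have z12 : dif z 1 2 != 0 by exact: dif_neq0.
have z13 : dif z 1 3 != 0 by exact: dif_neq0.
have z23 : dif z 2 3 != 0 by exact: dif_neq0.
have z21 : dif z 2 1 != 0 by exact: dif_neq0.
have z31 : dif z 3 1 != 0 by exact: dif_neq0.
rewrite /dy; move: z01 z02 z03 z12 z13 z23 z21 z31.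
move: (z _ 0) (z _ 1) (z _ 2) (z _ 3) (w _ 0) (w _ 1) (w _ 2) (w _ 3).
move=> a b c d a' b' c' d' h1 h2 h3 h4 h5 h6 h7 h8.
field.
by rewrite h1 h2 h3 h4 h5 h6 h7 h8.
Qed.

Lemma dy_dlog_cross_ratio :
  dy z w = dlog cross_ratio z w / (dif z 0 2 * dif z 3 1).
Proof.
rewrite generic_dy /dlog x' [X in X / cross_ratio z]mulrC mulfK //.
exact: cross_ratio_neq0.
Qed.

Let one_minusE : 1 - cross_ratio z =
  dif z 0 2 * dif z 3 1 / (dif z 0 3 * dif z 2 1).
Proof.
have z03 : dif z 0 3 != 0 by exact: dif_neq0.
have z21 : dif z 2 1 != 0 by exact: dif_neq0.
rewrite /cross_ratio; move: z03 z21; move: (z _ 0) (z _ 1) (z _ 2) (z _ 3).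
by move=> a b c d h1 h2; field; rewrite h2 h1.
Qed.

Lemma dy_dlog_one_minus_inv :
  dy z w = dlog (fun u => 1 - (cross_ratio u)^-1) z w / (dif z 0 3 * dif z 1 2).
Proof.
have dV := derivableP (derivableV cross_ratio_neq0 ex').
have := @derive_val _ _ _ _ _ _ _ (is_deriveB (is_derive_cst (1 : C) z w) dV).
rewrite (deriveV cross_ratio_neq0 ex') x' => E.
rewrite generic_dy; set L := (L in L / _ = _).
have {}E : 'D_w (fun u => 1 - (cross_ratio u)^-1) z =
    0 - - cross_ratio z ^- 2 * (cross_ratio z * L) := E.
rewrite /dlog {}E.
have x0 := cross_ratio_neq0; have x1 := cross_ratio_neq1.
have z03 : dif z 0 3 != 0 by exact: dif_neq0.
have z21 : dif z 2 1 != 0 by exact: dif_neq0.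
have z02 : dif z 0 2 != 0 by exact: dif_neq0.
have z31 : dif z 3 1 != 0 by exact: dif_neq0.
have -> : dif z 0 2 * dif z 3 1 =
    (1 - cross_ratio z) * (dif z 0 3 * dif z 2 1).
  by rewrite one_minusE divfK // mulf_neq0.
rewrite -[dif z 1 2]opprB.
move: x0 x1 z03 z21; move: L (cross_ratio z) (dif z 0 3) (dif z 2 1).
move=> L x p q x0 x1 p0 q0; field.
by rewrite x0 p0 q0 x1 -[_ - 1]opprB oppr_eq0 x1.
Qed.

Lemma dy_dlog_inv_one_minus :
  dy z w = dlog (fun u => (1 - cross_ratio u)^-1) z w / (dif z 0 1 * dif z 2 3).
Proof.
pose g := fun u => 1 - cross_ratio u.
have dB : is_derive z w (g : _ -> C) _ :=
  is_deriveB (is_derive_cst (1 : C) z w) is_derive_cross_ratio.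
have E := @deriveV _ _ g z w cross_ratio_neq1 (@ex_derive _ _ _ _ _ _ _ dB).
rewrite (@derive_val _ _ _ _ _ _ _ dB) in E.
rewrite generic_dy; set L := (L in L / _ = _).
have {}E : 'D_w (fun u => (1 - cross_ratio u)^-1) z =
    - (1 - cross_ratio z) ^- 2 * (0 - cross_ratio z * L) := E.
rewrite /dlog {}E.
have x0 := cross_ratio_neq0; have x1 := cross_ratio_neq1.
have z03 : dif z 0 3 != 0 by exact: dif_neq0.
have z21 : dif z 2 1 != 0 by exact: dif_neq0.
have -> : dif z 0 2 * dif z 3 1 =
    (1 - cross_ratio z) * (dif z 0 3 * dif z 2 1).
  by rewrite one_minusE divfK // mulf_neq0.
have -> : dif z 0 1 * dif z 2 3 = cross_ratio z * (dif z 0 3 * dif z 2 1).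
  by rewrite /cross_ratio divfK // mulf_neq0.
move: x0 x1 z03 z21; move: L (cross_ratio z) (dif z 0 3) (dif z 2 1).
move=> L x p q x0 x1 p0 q0; field.
by rewrite x0 p0 q0 x1.
Qed.

End DistinctEntries.
End CrossRatio.

Lemma dy_symmetric (C : numFieldType) (z w : 'rV[C]_4) :
  dy z w = - \sum_(i < 4)
    w ord0 i / \prod_(j < 4 | j != i) (z ord0 i - z ord0 j).
Proof.
have l1 : (lift ord0 ord0 : 'I_4) = 1 by exact: val_inj.
have l2 : (lift ord0 (lift ord0 ord0) : 'I_4) = 2 by exact: val_inj.
have l3 : (lift ord0 (lift ord0 (lift ord0 ord0)) : 'I_4) = 3 by exact: val_inj.
have l0 : (ord0 : 'I_4) = 0 by exact: val_inj.
pose d i j : C := if j != i then z ord0 i - z ord0 j else 1.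
have P (i : 'I_4) : \prod_(j < 4 | j != i) (z ord0 i - z ord0 j) =
    d i 0 * (d i 1 * (d i 2 * d i 3)).
  by rewrite big_mkcond /= !big_ord_recl big_ord0 /= l1 l2 l3 l0 mulr1.
rewrite /dy !big_ord_recl big_ord0 /= l1 l2 l3 l0 !P /d /= {P d l0 l1 l2 l3}.
rewrite !mul1r !mulr1 addr0.
move: (z _ 0) (z _ 1) (z _ 2) (z _ 3) (w _ 0) (w _ 1) (w _ 2) (w _ 3).
move=> a b c d a' b' c' d'.
have -> : (b - a) * ((b - c) * (b - d)) = - ((a - b) * (b - c) * (b - d)).
  by ring.
have -> : (c - a) * ((c - b) * (c - d)) = (a - c) * (b - c) * (c - d).
  by ring.
have -> : (d - a) * ((d - b) * (d - c)) = - ((a - d) * (b - d) * (c - d)).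
  by ring.
rewrite !invrN !mulrN !mulrA; set p := _^-1; set q := _^-1.
by rewrite !opprD !opprK !addrA.
Qed.

Lemma dy_permute (C : numFieldType) (s : {perm 'I_4}) (z w : 'rV[C]_4) :
  dy (col_perm s z) (col_perm s w) = dy z w.
Proof.
rewrite !dy_symmetric [in RHS](reindex_perm s) /=; congr (- _).
apply: eq_bigr => i _; rewrite !mxE; congr (_ / _).
rewrite [RHS](reindex_perm s) /=; apply: eq_big => [j|j _]; last by rewrite !mxE.
by rewrite (inj_eq perm_inj).
Qed.

(* Each space of differentials is the space of coordinate vectors indexed by  *)
(* the corresponding cells; psl(2) is 'cV[C]_3 with coordinates (da, db, dc). *)
Section Maps.
Variables (C : numFieldType) (V : finType) (M : oriented_closed_3manifold V).
Variable zeta : V -> C.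

Definition f1_fun (v : 'cV[C]_3) : {ffun V -> C^o} :=
  [ffun i => 2 * zeta i * v 0 0 + v 1 0 - zeta i ^+ 2 * v 2 0].

Definition values (g : V -> C) (t : 4.-tuple V) : 'rV[C]_4 :=
  \row_m g (tnth t m).

(* The positive ordering chosen for s is immaterial, by f2E below; so is the  *)
(* ordering of an edge in f3_fun, by f3E.                                     *)
Definition f2_fun (dz : {ffun V -> C^o}) : {ffun tetrahedron M -> C^o} :=
  [ffun s => dy (values zeta (ordered_tetrahedron s))
                (values dz (ordered_tetrahedron s))].

(* dy_ijkl, the coordinate at the tetrahedron with vertices i, j, k, l *)
Definition coord_at (y : {ffun tetrahedron M -> C^o}) (i j k l : V) : C :=
  oapp y 0 (insub [set i; j; k; l]%SET).

(* Each edge {k, l} of the link of {i, j} occurs in the sum exactly once, in  *)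
(* the order that makes ijkl positive.                                        *)
Definition dlnomega (y : {ffun tetrahedron M -> C^o}) (i j : V) : C :=
  (zeta i - zeta j) *
  \sum_(kl : V * V | positive M [tuple i; j; kl.1; kl.2])
     (zeta kl.1 - zeta kl.2) * coord_at y i j kl.1 kl.2.

Definition f3_fun (y : {ffun tetrahedron M -> C^o}) : {ffun edge M -> C^o} :=
  [ffun e => dlnomega y (ordered_edge e).1 (ordered_edge e).2].

Lemma f1_linear : linear f1_fun.
Proof.
move=> a u v; apply/ffunP => i; rewrite !ffunE !mxE /GRing.scale /=.
by ring.
Qed.
HB.instance Definition _ :=
  GRing.isLinear.Build C 'cV[C]_3 {ffun V -> C^o} *:%R f1_fun f1_linear.

Lemma f2_linear : linear f2_fun.
Proof.
move=> a u v; apply/ffunP => s; rewrite !ffunE /dy !mxE !ffunE /GRing.scale /=.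
by ring.
Qed.
HB.instance Definition _ :=
  GRing.isLinear.Build C {ffun V -> C^o} {ffun tetrahedron M -> C^o} *:%R
    f2_fun f2_linear.

Lemma dlnomega_linear a u v i j :
  dlnomega (a *: u + v) i j = a * dlnomega u i j + dlnomega v i j.
Proof.
rewrite /dlnomega mulrCA -mulrDr; congr (_ * _).
rewrite mulr_sumr -big_split.
apply: eq_bigr => kl _; rewrite /coord_at /=.
case: insub => [s|] /=; last by rewrite !mulr0 addr0.
by rewrite !ffunE mulrDr mulrCA.
Qed.

Lemma f3_linear : linear f3_fun.
Proof. by move=> a u v; apply/ffunP => e; rewrite !ffunE dlnomega_linear. Qed.
HB.instance Definition _ :=
  GRing.isLinear.Build C {ffun tetrahedron M -> C^o} {ffun edge M -> C^o} *:%R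
    f3_fun f3_linear.

Definition f1 : 'Hom('cV[C]_3, {ffun V -> C^o}) := linfun f1_fun.

Definition f2 : 'Hom({ffun V -> C^o}, {ffun tetrahedron M -> C^o}) :=
  linfun f2_fun.

Definition f3 : 'Hom({ffun tetrahedron M -> C^o}, {ffun edge M -> C^o}) :=
  linfun f3_fun.

Lemma f1E v (i : V) :
  f1 v i = 2 * zeta i * v 0 0 + v 1 0 - zeta i ^+ 2 * v 2 0.
Proof. by rewrite /f1 lfunE /= ffunE. Qed.

Lemma f2E dz (s : tetrahedron M) (t : 4.-tuple V) :
  uniq t -> [set x in t]%SET = val s ->
  f2 dz s = dy (values zeta t) (values dz t).
Proof.
move=> ut ts; rewrite /f2 lfunE /= ffunE /ordered_tetrahedron.
set o := xchoose _.
have /andP[po /eqP os] : positive M o && ([set x in o]%SET == val s).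
  exact: xchooseP (tetrahedron_positive s).
have /andP[uo _] := positive_ordering po.
have /tuple_permP[p ep] : perm_eq o t.
  apply: uniq_perm => // x; have /setP/(_ x) := etrans os (esym ts).
  by rewrite !inE.
have vp (g : V -> C) : values g o = col_perm p (values g t).
  apply/rowP => m; rewrite !mxE; congr (g _).
  have -> : o = [tuple tnth t (p i) | i < 4] by exact: val_inj.
  by rewrite tnth_mktuple.
by rewrite !vp dy_permute.
Qed.

Lemma positive_swap (i j k l : V) :
  positive M [tuple i; j; k; l] = positive M [tuple j; i; l; k].
Proof.
pose p : {perm 'I_4} := mulg (tperm (0 : 'I_4) 1) (tperm (2 : 'I_4) 3).
have pE (a b c d : V) : permute p [tuple a; b; c; d] = [tuple b; a; d; c].
  by apply: eq_from_tnth => m; rewrite tnth_mktuple permM; case: m =>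
    [[|[|[|[|//]]]] Hm]; rewrite !permE /= ?permE.
have pos (a b c d : V) : positive M [tuple a; b; c; d] ->
    positive M [tuple b; a; d; c].
  move=> H; rewrite -pE positive_permute; last exact: positive_ordering.
  by rewrite H odd_permM !odd_tperm.
by apply/idP/idP; apply: pos.
Qed.

Lemma dlnomegaC y (i j : V) : dlnomega y i j = dlnomega y j i.
Proof.
rewrite /dlnomega -[zeta j - _]opprB mulNr -mulrN; congr (_ * _).
rewrite -sumrN (reindex_inj (h := fun kl : V * V => (kl.2, kl.1))) /=; last first.
  by move=> [a b] [c d] /= [-> ->].
apply: eq_big => [[k l]|[k l] _] /=.
  exact: positive_swap.
rewrite -mulNr opprB; congr (_ * _); rewrite /coord_at.
congr (oapp _ _ (insub _)); apply/setP => x; rewrite !inE.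
by rewrite -!orbA orbCA; do 2!congr (_ || _); rewrite orbC.
Qed.

Lemma f3E y (e : edge M) (i j : V) : val e = [set i; j]%SET ->
  f3 y e = dlnomega y i j.
Proof.
move=> eij; rewrite /f3 lfunE /= ffunE /ordered_edge; set o := xchoose _.
have /andP[ne12 /eqP oe] : (o.1 != o.2) && ([set o.1; o.2]%SET == val e).
  exact: xchooseP (edge_ordering e).
move/setP: (etrans oe eij) => oij.
have := oij o.1; have := oij o.2; rewrite !inE !eqxx orbT /=.
move=> /esym/orP[]/eqP e2 /esym/orP[]/eqP e1; rewrite ?e1 ?e2 //; last 1 first.
- by move: ne12; rewrite e1 e2 eqxx.
- by move: ne12; rewrite e1 e2 eqxx.
exact: dlnomegaC.
Qed.

End Maps.

(* Main.v *)
Require Import Defs.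
From mathcomp Require Import all_boot all_order all_algebra all_reals.
From mathcomp.real_closed Require Import complex.
From mathcomp Require Import perm ring.

Set Implicit Arguments.
Unset Strict Implicit.
Unset Printing Implicit Defensive.

Local Open Scope ring_scope.
Import GRing.Theory.

(** Why the sequence is a complex.

    The image of f1 consists of the values at the points zeta_i of polynomials
    of degree at most 2 (infinitesimal Moebius transformations), while dy_ijkl
    is, up to sign, a third divided difference at four of these points, which
    annihilates such polynomials: this is [dy_quadratic], and gives [f2_f1].

    For f3 o f2, fix an edge ij.  Partial fractions in the coefficients of
    dy_ijkl show that zeta_kl dy_ijkl = F l - F k, for a potential F attached
    to ij, where F m only involves dz_i, dz_j and dz_m ([dy_edge_potential]).
    The sum over the link of ij, which is an oriented cycle, therefore
    telescopes ([sum_positive_telescope]).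

    The cycle enters through a count only: a vertex m of the link of ij is the
    end of as many positively oriented edges as it is the origin
    ([card_positive]).  Indeed the triangle ijm lies in exactly two tetrahedra
    ([triangle_cofaces]), because its link, an iterated vertex link, is a
    0-sphere; and the orientations of these two tetrahedra are coherent, so
    that one of them gives an edge leaving m and the other an edge entering
    m. *)

(** * Links and orientations *)

(** Iterating links lets the link of a triangle be read off from the spheres
    within spheres by which a closed manifold is characterized. *)
Lemma link_link (V : finType) (K : {set {set V}}) (s t : {set V}) :
  t != set0 -> [disjoint t & s] -> link (link K s) t = link K (t :|: s).
Proof.
move=> t0 ts; apply/setP => u; rewrite !inE.
have [->//|u0] /= := eqVneq u set0.
rewrite -!setI_eq0 setIUl setIUr !setU_eq0 !setI_eq0 ts (negPf u0) andbT /=.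
by rewrite setUA andbA.
Qed.

Lemma card_pair_pred (T : finType) (p : pred T) (a b : T) :
  a != b -> (forall x, p x -> x \in [set a; b]) ->
  #|[set x | p x]| = (p a + p b)%N.
Proof.
move=> ab pP; rewrite -sum1_card big_mkcond (bigD1 a) //= (bigD1 b) 1?eq_sym //=.
rewrite big1 => [|x /andP[xa xb]].
  by rewrite !inE addn0; do 2!case: (p _).
rewrite inE; case: ifP => // /pP.
by rewrite !inE (negPf xa) (negPf xb).
Qed.

Section Orientation.
Variables (V : finType) (M : oriented_closed_3manifold V).
Implicit Types i j k l m a : V.

Lemma set_of_tuple4 i j k l :
  [set x in [tuple i; j; k; l]] = [set i; j; k; l].
Proof. by apply/setP => x; rewrite !inE -!orbA. Qed.

Lemma ordering_swap i j k l :
  tetrahedron_ordering M [tuple i; j; k; l] =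
  tetrahedron_ordering M [tuple i; j; l; k].
Proof.
rewrite /tetrahedron_ordering !set_of_tuple4 setUAC; congr (_ && _).
by apply: perm_uniq; rewrite !perm_cons (perm_catC [:: k] [:: l]).
Qed.

Lemma positive_swap_last i j k l : tetrahedron_ordering M [tuple i; j; k; l] ->
  positive M [tuple i; j; l; k] = ~~ positive M [tuple i; j; k; l].
Proof.
move=> o; have -> : [tuple i; j; l; k] =
    permute (tperm (2 : 'I_4) 3) [tuple i; j; k; l].
  apply: eq_from_tnth => n; rewrite tnth_mktuple.
  by case: n => [[|[|[|[|//]]]] Hn]; rewrite !permE.
by rewrite positive_permute // odd_tperm addbT.
Qed.

Lemma ordering_linkE i j m a :
  uniq [:: i; j; m] ->
  tetrahedron_ordering M [tuple i; j; m; a] =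
  ([set a] \in link M [set i; j; m]).
Proof.
move=> u; rewrite /tetrahedron_ordering set_of_tuple4 /link !inE.
rewrite -card_gt0 cards1 disjoints1 setUC /=; congr (_ && _).
move: u; rewrite /= !inE !negb_or -!andbA => /and4P[-> -> -> _] /=.
by rewrite andbT !(eq_sym a).
Qed.

Lemma link_triangle i j m : uniq [:: i; j; m] ->
  [set i; j; m] \in (M : {set {set V}}) -> sphere0 (link M [set i; j; m]).
Proof.
rewrite /= !inE negb_or => /and3P[/andP[ij im] jm _] ijm.
have [_ face] := complexP M.
have dij : [disjoint [set j] & [set i]] by rewrite disjoints1 inE eq_sym.
have dm : [disjoint [set m] & [set j; i]].
  by rewrite disjoints1 !inE !(eq_sym m) negb_or jm.
have n0 v : [set v] != set0 by rewrite -card_gt0 cards1.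
have -> : [set i; j; m] = [set m] :|: [set j; i].
  by rewrite setUC [[set j; i]]setUC.
have ji : [set j] \in link M [set i].
  rewrite inE n0 dij; apply: face ijm _ _; last by rewrite -card_gt0 cards2.
  by rewrite [[set j; i]]setUC subsetUl.
have [_ /(_ _ ji) + _] := manifoldP (vertexP M i).
rewrite link_link // => -[_ /(_ m)].
rewrite link_link //; apply.
by rewrite inE n0 dm [[set j; i]]setUC setUC.
Qed.

(** A 0-sphere consists of two points, and the points of the link of a triangle
    are the apices of the tetrahedra that contain it. *)
Lemma triangle_cofaces i j m : uniq [:: i; j; m] ->
  [set i; j; m] \in (M : {set {set V}}) ->
  exists a b, a != b /\
    forall x, tetrahedron_ordering M [tuple i; j; m; x] = (x \in [set a; b]).
Proof.
move=> u /(link_triangle u)[/eqP/cards2P[s [t [st Lst]]] L0].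
have single r : r \in link M [set i; j; m] -> exists a, r = [set a].
  by rewrite -L0 inE => /andP[_ /cards1P].
have [a sa] : exists a, s = [set a] by apply: single; rewrite Lst !inE eqxx.
have [b tb] : exists b, t = [set b].
  by apply: single; rewrite Lst !inE eqxx orbT.
exists a, b; split; first by apply: contraNneq st => ab; rewrite sa tb ab.
by move=> x; rewrite ordering_linkE // Lst sa tb !inE !(inj_eq set1_inj).
Qed.

(** Of the two apices a and b over the triangle ijm, coherence makes exactly
    one of ijma and ijmb positive; as exchanging the last two vertices reverses
    the sign, the other one is positive in the order ijbm. Both sides are thus
    1, or 0 when ijm is not a face of any tetrahedron. *)
Lemma card_positive i j m :
  #|[set a | positive M [tuple i; j; m; a]]| =
  #|[set a | positive M [tuple i; j; a; m]]|.
Proof.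
have [/existsP[c oc]|none] :=
  boolP [exists a, tetrahedron_ordering M [tuple i; j; m; a]]; last first.
  have none' a : tetrahedron_ordering M [tuple i; j; m; a] = false.
    by apply: contraNF none => oa; apply/existsP; exists a.
  apply: eq_card => a; rewrite !inE.
  apply/idP/idP => /positive_ordering; last rewrite ordering_swap.
    by rewrite none'.
  by rewrite none'.
have /andP[uc Kc] := oc.
have u : uniq [:: i; j; m].
  by apply: subseq_uniq (prefix_subseq [:: i; j; m] [:: c]) uc.
have Kijm : [set i; j; m] \in (M : {set {set V}}).
  have [_ face] := complexP M; apply: face Kc _ _.
    by rewrite set_of_tuple4 subsetUl.
  by apply/set0Pn; exists i; rewrite !inE eqxx.
have [a [b [ab E]]] := triangle_cofaces u Kijm.
have oa : tetrahedron_ordering M [tuple i; j; m; a] by rewrite E !inE eqxx.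
have ob : tetrahedron_ordering M [tuple i; j; m; b] by rewrite E !inE eqxx orbT.
have pab := positive_coherent ab oa ob.
rewrite !(@card_pair_pred _ _ a b) //.
- rewrite (positive_swap_last oa) (positive_swap_last ob) pab.
  by case: (positive _ _).
- by move=> x /positive_ordering; rewrite ordering_swap E.
- by move=> x /positive_ordering; rewrite E.
Qed.

End Orientation.

(** The oriented link of ij has zero boundary, so that the sum of the increments
    of a function over its edges vanishes. *)
Lemma sum_positive_telescope (V : finType) (M : oriented_closed_3manifold V)
    (A : zmodType) (F : V -> A) (i j : V) :
  \sum_(kl : V * V | positive M [tuple i; j; kl.1; kl.2])
    (F kl.2 - F kl.1) = 0.
Proof.
rewrite sumrB; apply/eqP; rewrite subr_eq0; apply/eqP.
rewrite (reindex_inj (h := fun kl : V * V => (kl.2, kl.1))) /=; last first.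
  by move=> [a b] [c d] /= [-> ->].
have sum_fst (P : V -> V -> bool) :
    \sum_(p : V * V | P p.1 p.2) F p.1 = \sum_m F m *+ #|[set a | P m a]|.
  rewrite -(pair_big_dep xpredT P (fun m _ => F m)) /=.
  by apply: eq_bigr => m _; rewrite sumr_const cardsE.
rewrite (sum_fst (fun m a => positive M [tuple i; j; a; m])).
rewrite (sum_fst (fun m a => positive M [tuple i; j; m; a])).
by apply: eq_bigr => m _; rewrite card_positive.
Qed.

(** * Identities for the differential of the cross-ratio *)

Section FieldIdentities.
Variables (C : numFieldType).

(** A primitive of zeta_kl dy_ijkl as a function of the pair kl. It comes from
    zeta_kl / (zeta_ik zeta_il) = 1 / zeta_ik - 1 / zeta_il, the same with j in
    place of i, and the cancellation of zeta_kl in the terms in dz_k, dz_l. *)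
Definition edge_potential (zi zj wi wj z w : C) : C :=
  wi / ((zi - zj) * (zi - z)) - wj / ((zi - zj) * (zj - z))
  + w / ((zi - z) * (zj - z)).

Lemma dy_edge_potential (z w : 'rV[C]_4) : distinct_entries z ->
  let: F := fun m => edge_potential (z 0 0) (z 0 1) (w 0 0) (w 0 1)
                       (z 0 m) (w 0 m) in
  (z 0 2 - z 0 3) * dy z w = F 3 - F 2.
Proof.
move=> zP; rewrite /dy /edge_potential.
have := (dif_neq0 zP (isT : (0 : 'I_4) != 1),
  dif_neq0 zP (isT : (0 : 'I_4) != 2), dif_neq0 zP (isT : (0 : 'I_4) != 3),
  dif_neq0 zP (isT : (1 : 'I_4) != 2), dif_neq0 zP (isT : (1 : 'I_4) != 3),
  dif_neq0 zP (isT : (2 : 'I_4) != 3)).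
move: (z _ 0) (z _ 1) (z _ 2) (z _ 3) (w _ 0) (w _ 1) (w _ 2) (w _ 3).
move=> a b c d a' b' c' d' h; field.
by rewrite !h.
Qed.

(** By [dy_symmetric], dy is the opposite of the divided difference of w at the
    four entries of z, and divided differences of order 3 vanish on polynomials
    of degree at most 2. *)
Lemma dy_quadratic (z : 'rV[C]_4) (p q r : C) : distinct_entries z ->
  dy z (\row_m (p * z 0 m + q - z 0 m ^+ 2 * r)) = 0.
Proof.
move=> zP; rewrite /dy !mxE.
have := (dif_neq0 zP (isT : (0 : 'I_4) != 1),
  dif_neq0 zP (isT : (0 : 'I_4) != 2), dif_neq0 zP (isT : (0 : 'I_4) != 3),
  dif_neq0 zP (isT : (1 : 'I_4) != 2), dif_neq0 zP (isT : (1 : 'I_4) != 3),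
  dif_neq0 zP (isT : (2 : 'I_4) != 3)).
move: (z _ 0) (z _ 1) (z _ 2) (z _ 3) => a b c d h; field.
by rewrite !h.
Qed.

End FieldIdentities.

(** * The two compositions *)

Section ChainComplex.
Variables (C : numFieldType) (V : finType) (M : oriented_closed_3manifold V).
Variable zeta : V -> C.
Hypothesis zetaP : forall i j : V, i != j ->
  [set i; j] \in (M : {set {set V}}) -> zeta i - zeta j != 0.

Lemma distinct_values (t : 4.-tuple V) : tetrahedron_ordering M t ->
  distinct_entries (values zeta t).
Proof.
move=> /andP[ut tM] a b ab; rewrite !mxE -subr_eq0 zetaP //.
  by apply: contraNneq ab => /(elimT (tuple_uniqP _) ut) ->.
have [_ face] := complexP M; apply: face tM _ _.
  by apply/subsetP => x; rewrite !inE => /orP[]/eqP->; rewrite mem_tnth.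
by apply/set0Pn; exists (tnth t a); rewrite !inE eqxx.
Qed.

Lemma f2_f1 : (f2 M zeta \o f1 zeta = 0)%VF.
Proof.
apply/lfunP => v; rewrite comp_lfunE zero_lfunE; apply/ffunP => s.
rewrite !ffunE.
have /andP[pt /eqP ts] := xchooseP (tetrahedron_positive s).
have ot := positive_ordering pt; have /andP[ut _] := ot.
rewrite (f2E _ _ ut ts).
rewrite -[RHS](dy_quadratic (2 * v 0 0) (v 1 0) (v 2 0) (distinct_values ot)).
by congr dy; apply/rowP => m; rewrite !mxE f1E mulrAC.
Qed.

Lemma f3_f2 : (f3 M zeta \o f2 M zeta = 0)%VF.
Proof.
apply/lfunP => w; rewrite comp_lfunE zero_lfunE; apply/ffunP => e.
have /andP[_ /eqP/esym eij] := xchooseP (edge_ordering e).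
rewrite (f3E _ _ eij) !ffunE /dlnomega; set i := _.1; set j := _.2.
pose F m := edge_potential (zeta i) (zeta j) (w i) (w j) (zeta m) (w m).
rewrite -[RHS](mulr0 (zeta i - zeta j)); congr (_ * _).
rewrite -[RHS](sum_positive_telescope M F i j).
apply: eq_bigr => -[k l] /= pkl.
have ot := positive_ordering pkl; have /andP[ut tM] := ot.
have -> : coord_at (f2 M zeta w) i j k l =
    dy (values zeta [tuple i; j; k; l]) (values w [tuple i; j; k; l]).
  rewrite /coord_at; case: insubP => [s _ sE|] /=.
    by apply: f2E; rewrite // set_of_tuple4.
  by rewrite inE -set_of_tuple4 tM cardsE (card_uniqP ut).
have := dy_edge_potential (values w [tuple i; j; k; l]) (distinct_values ot).
by rewrite !mxE.
Qed.

End ChainComplex.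

Theorem theorem2 (R : realType) (V : finType)
    (M : oriented_closed_3manifold V) (zeta : V -> R[i])
    (general_position :
       forall i j : V, i != j -> [set i; j] \in (M : {set {set V}}) ->
         zeta i - zeta j != 0) :
  (f3 M zeta \o f2 M zeta = 0)%VF /\ (f2 M zeta \o f1 zeta = 0)%VF.
Proof. by split; [exact: f3_f2|exact: f2_f1]. Qed.
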